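(* Let $G$ be a finite group, let $G=AB$ be a $p$-Baer factorisation (where $A$ and $B$ are subgroups of $G$ and $p\in\pi(G)$), and let $P$ be a Sylow $p$-subgroup of $G$. Then there exist unique primes $q$ and $r$ such that $i_G(x)$ is a $q$-number for every $p$-element $x\in A$, and $i_G(y)$ is an $r$-number for every $p$-element $y\in B$, respectively. (Eventually $p\in\{q,r\}$ or $q=r$; that is, these cases may occur.) Moreover, $P\leqslant C_G\bigl(O_{\{q,r\}'}(F(G))\bigr)$, and $P\,O_q(G)\,O_r(G)$ is normal in $G$. Further: (1) If $q=r=p$, then $G$ is $p$-decomposable. (2) If $p\notin\{q,r\}$, then $P$ is abelian.
   Context: All groups are finite. $\pi(G)$ is the set of prime divisors of $|G|$. For $x\in G$, the index of $x$ in $G$ is $i_G(x)=|G:C_G(x)|$, the size of the conjugacy class of $x$ in $G$. The number $1$ is regarded as a power of every prime; a $q$-number is a power of $q$ (possibly $1$). ''$G=AB$ is the product of the subgroups $A$ and $B$'' means that $G=\{ab : a\in A, b\in B\}$. For $p\in\pi(G)$, such a product $G=AB$ is a $p$-Baer factorisation if $i_G(x)$ is a prime power for every $p$-element $x\in A\cup B$. $C_G(H)$ is the centraliser of $H$ in $G$, and $F(G)$ is the Fitting subgroup of $G$. For a set of primes $\pi$, $\pi'$ is the complementary set of primes and $O_\pi(H)$ is the largest normal $\pi$-subgroup of $H$; for a prime $q$, $O_q(H)=O_{\{q\}}(H)$ and $O_{q'}(H)=O_{\{q\}'}(H)$. A group $G$ is $p$-decomposable if $G=O_p(G)\times O_{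p'}(G)$.
   Formalization: Uniqueness of q (resp. r) is claimed only when some p-element of A (resp. B) has index different from 1; otherwise (e.g. G cyclic of order p) every prime qualifies. Existence is unconditional, and the remaining conclusions are proved for all admissible primes q and r. *)

(* Defs.v *)
From mathcomp Require Import all_boot all_fingroup all_solvable.

Set Implicit Arguments.
Unset Strict Implicit.
Unset Printing Implicit Defensive.

Local Open Scope group_scope.

Definition cl_index (gT : finGroupType) (G : {group gT}) (x : gT) : nat :=
  #|G : 'C_G[x]|.

(* [t.-nat n] for a prime [t] says that [n] is a power of [t]; the value 1 is
   a power of every prime. *)
Definition prime_power (n : nat) : Prop := exists2 t : nat, prime t & t.-nat n.

Definition Baer_factorisation (gT : finGroupType) (p : nat)
    (G A B : {group gT}) : Prop :=
  A * B = G /\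
  (forall x : gT, x \in A :|: B -> p.-elt x -> prime_power (cl_index G x)).

Definition index_prime (gT : finGroupType) (p : nat) (G A : {group gT})
    (q : nat) : Prop :=
  prime q /\ (forall x : gT, x \in A -> p.-elt x -> q.-nat (cl_index G x)).

(* The prime is determined by the indices as soon as some p-element of A has
   index different from 1; otherwise every prime is an [index_prime], so
   uniqueness can only be claimed under this condition. *)
Definition nontrivial_index (gT : finGroupType) (p : nat)
    (G A : {group gT}) : Prop :=
  exists x : gT, [/\ x \in A, p.-elt x & cl_index G x <> 1%N].

Definition exists_unique_index_prime (gT : finGroupType) (p : nat)
    (G A : {group gT}) : Prop :=
  (exists q : nat, index_prime p G A q) /\
  (nontrivial_index p G A -> exists! q : nat, index_prime p G A q).

Definition p_decomposable (gT : finGroupType) (p : nat)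
    (G : {group gT}) : Prop :=
  'O_p(G) \x 'O_p^'(G) = G.

(* Main.v *)
Require Import Defs.
From mathcomp Require Import all_boot all_fingroup all_solvable.
From mathcomp Require Import all_order all_algebra all_field all_character.
From mathcomp Require Import ring zify.

(** The key fact is that a p-element [x] whose class in [G] has q-power size
    lies in ['O_{q, p}(G)].  For [q = p] the conjugates of [x] stay in a Sylow
    p-subgroup containing [x].  For [q <> p], induction reduces to the case where
    [G] is generated by the class [K] of [x].  If [p] divides [#|G^`(1)|], let [t]
    in [G^`(1)] have order [p].  Frobenius' formula expresses the number of
    factorisations of [t] into [n] elements of [K] as a sum over the irreducible
    characters [chi] of [chi 1 * chi t^-1 * omega_chi(K) ^ n], up to a constant;
    rotating factorisations shows that it tends to 0 p-adically as [n] runs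
    through highly p-divisible integers, while [omega_chi(K) ^ n] becomes
    idempotent.  In the limit, a sum of [chi 1 * chi t^-1] over some set of [chi]
    containing the linear ones is 0.  By Burnside's lemma the nonlinear [chi] of
    degree prime to [q] vanish at [x], so this sum is [#|G : G^`(1)|], a power of
    [p], plus a multiple of [q]: a contradiction.  Hence [G^`(1)] is a p'-group,
    [x] normalises a Sylow q-subgroup [Q] of it, and [G = Q <[x]>].

    Choose Sylow p-subgroups with [P = PA * PB].  The key fact puts [P] inside
    ['O_{q, p}(G) * 'O_{r, p}(G)], which is therefore [P * 'O_q(G) * 'O_r(G)].  That
    the elements of [PA] share one prime is shown by multiplying elements [x], [y]
    whose classes have coprime sizes: all products of conjugates of [x] and [y] are
    conjugate to [x * y], so if [x * y] has no more conjugates than [x], then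
    [x ^: G] is a union of cosets of the group generated by the [y ^ g * y^-1]. *)

Set Implicit Arguments.
Unset Strict Implicit.
Unset Printing Implicit Defensive.

Import Order.TTheory GRing.Theory Num.Theory.

Local Open Scope group_scope.

(** * Algebraic integers *)

Section AlgebraicIntegers.
Local Open Scope ring_scope.

(* The values of [e] are only idempotent modulo [M], not congruent to 0 or 1, so
   [D] is the product of all [c + \sum_(i in B) a i] for B a subset of [s]: the
   scalar [f] makes it possible to split along [e j] and [1 - e j]. *)
Lemma Aint_idempotent_sum (I : eqType) (s : seq I) (a : I -> algC) (q : nat) c :
    c \in Aint -> c / q%:R \notin Aint ->
    {in s, forall i, a i \in Aint /\ a i / q%:R \in Aint} ->
  exists D, [/\ D \in Aint, D != 0 & forall (M : algC) (e : I -> algC) f,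
    f \in Aint -> {in s, forall i, e i \in Aint /\ (e i ^+ 2 - e i) / M \in Aint} ->
    f * (c + \sum_(i <- s) a i * e i) / M \in Aint -> f * D / M \in Aint].
Proof.
move=> Zc q'c; elim: s c Zc q'c => [|j s IHs] c Zc q'c Za.
  exists c; split=> [||M e f _ _] //.
    by apply: contraNneq q'c => ->; rewrite mul0r.
  by rewrite big_nil addr0.
have [Zaj Zajq] := Za j (mem_head _ _).
have Zas: {in s, forall i, a i \in Aint /\ a i / q%:R \in Aint}.
  by move=> i si; apply: Za; rewrite inE si orbT.
have [D0 [ZD0 nzD0 hD0]] := IHs c Zc q'c Zas.
have q'ca: (c + a j) / q%:R \notin Aint.
  by apply: contra q'c => Zca; rewrite -(addrK (a j) c) mulrBl rpredB.
have [D1 [ZD1 nzD1 hD1]] := IHs _ (rpredD Zc Zaj) q'ca Zas.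
exists (D0 * D1); split=> [||M e f Zf Ze]; [exact: rpredM | exact: mulf_neq0 |].
rewrite big_cons; set S := \sum_(i <- s) _ => Zsum.
have [Zej Zej2] := Ze j (mem_head _ _).
have Zes: {in s, forall i, e i \in Aint /\ (e i ^+ 2 - e i) / M \in Aint}.
  by move=> i si; apply: Ze; rewrite inE si orbT.
have Z0: f * (1 - e j) * D0 / M \in Aint.
  apply: hD0 Zes _; first by apply: rpredM => //; apply: rpredB.
  have ->: f * (1 - e j) * (c + S) / M = f * (c + (a j * e j + S)) / M * (1 - e j)
       + f * a j * ((e j ^+ 2 - e j) / M) by rewrite !expr2; ring.
  by apply: rpredD; apply: rpredM => //; [apply: rpredB | apply: rpredM].
have Z1: f * e j * D1 / M \in Aint.
  apply: hD1 Zes _; first by apply: rpredM.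
  have ->: f * e j * (c + a j + S) / M = f * (c + (a j * e j + S)) / M * e j
       - f * a j * ((e j ^+ 2 - e j) / M) by rewrite !expr2; ring.
  by apply: rpredB; apply: rpredM => //; apply: rpredM.
have ->: f * (D0 * D1) / M = f * (1 - e j) * D0 / M * D1 + f * e j * D1 / M * D0.
  by ring.
by apply: rpredD; apply: rpredM.
Qed.

(** A nonzero [D] divides a nonzero integer, the constant term of its minimal polynomial stripped of
    factors [X]; a power of [p] dividing [D] divides this integer too. *)
Lemma Aint_pfactor_bound (p : nat) D :
  (1 < p)%N -> D \in Aint -> D != 0 -> exists L, D / (p ^ L)%:R \notin Aint.
Proof.
move=> p_gt1 ZD nzD.
have [m [Q nzQ0 DP]] := multiplicity_XsubC (minCpoly D) 0.
have nzP: minCpoly D != 0 by rewrite monic_neq0 ?minCpoly_monic.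
rewrite nzP /= in nzQ0; rewrite subr0 in DP.
have ZQ i: Q`_i \in Num.int.
  have:= polyOverP ZD (i + m)%N; rewrite DP coefMXn ltnNge leq_addl /=.
  by rewrite addnK.
have rootQ: root Q D.
  have:= root_minCpoly D; rewrite DP rootM => /orP[] //.
  by rewrite /root hornerXn expf_eq0 (negPf nzD) andbF.
set R := drop_poly 1 Q.
have ZR: R.[D] \in Aint.
  rewrite horner_coef rpred_sum // => i _; rewrite rpredM ?rpredX //.
  by rewrite coef_drop_poly Aint_Cint.
have DQ0: Q`_0 = - (R.[D] * D).
  apply/eqP; rewrite -addr_eq0 -[X in _ + _ == X](rootP rootQ).
  rewrite -{2}(poly_take_drop 1 Q) hornerD hornerM hornerX -/R.
  rewrite (size1_polyC (size_take_poly _ _)) hornerC coef_take_poly.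
  by rewrite [_ * D]mulrC.
have nzQ: Q`_0 != 0 by move: nzQ0; rewrite /root horner_coef0.
(* [p ^ L] exceeds this integer in absolute value. *)
have /intrP[z Dz] := ZQ 0; pose L := `|z|%N; exists L.
apply/negP=> ZDL.
have nzpL: (p ^ L)%:R != 0 :> algC by rewrite pnatr_eq0 expn_eq0 -(subnKC p_gt1).
have: Q`_0 / (p ^ L)%:R \in Num.int.
  apply: Cint_rat_Aint; last by rewrite DQ0 mulNr -mulrA rpredN rpredM.
  by rewrite Dz rpred_div ?rpred_nat ?rpred_int.
move/norm_intr_ge1; rewrite mulf_neq0 ?invr_eq0 // => /(_ isT).
rewrite normf_div normr_nat ler_pdivlMr ?mul1r; last by rewrite ltr0n expn_gt0 -(subnKC p_gt1).
rewrite Dz -intr_norm -abszE -pmulrn ler_nat -/L leqNgt.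
by rewrite ltn_expl.
Qed.

(** The powers of [w] lie in a finitely generated additive group of algebraic integers, so by
    pigeonhole two of them agree modulo [N]. From the first one on, the powers are periodic modulo
    [N], and exponents past that point divisible by the period give idempotents. *)
Lemma Aint_exp_idempotent w N : (0 < N)%N -> w \in Aint ->
  exists2 n, (0 < n)%N & forall k, (0 < k)%N ->
    ((w ^+ (n * k)) ^+ 2 - w ^+ (n * k)) / N%:R \in Aint.
Proof.
case: N => // N _ Zw; set M := N.+1%:R.
have [|S [ringS Sw [[m Y] /= _ S_P]]] := @Aint_subring_exists [:: w].
  by move=> _ /[!inE]/eqP->.
have mulS: mulr_closed S by case: ringS => S1 _ SM; split.
have AS: {subset S <= Aint} := fin_Csubring_Aint mulS S_P.
have Swn n: w ^+ n \in S.
  have Sw1: w \in S by apply: Sw; rewrite inE.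
  case: mulS => S1 SM; elim: n => [|n IHn]; first by rewrite expr0.
  by rewrite exprS SM.
pose T := {ffun 'I_m -> 'I_N.+1}.
have /fin_all_exists[c Dc] : forall n : 'I_(#|{: T}|).+1,
    exists c : int ^ m, w ^+ n = \sum_(i < m) Y`_i *~ c i.
  by move=> n; have /S_P[c Dc] := Swn n; exists c.
pose r n : T := [ffun i => inord `|(c n i %% N.+1%:Z)%Z|].
have [i [j [lt_ij Drij]]] :
    exists i j : 'I_(#|{: T}|).+1, (i < j)%N /\ r i = r j.
  have: ~~ injectiveb r.
    by apply/injectiveP => /leq_card; rewrite card_ord ltnn.
  case/injectivePn=> i [j neq_ij Dr].
  case: (ltngtP i j) => [lt_ij | lt_ji | /val_inj eq_ij].
  - by exists i, j.
  - by exists j, i.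
  by rewrite eq_ij eqxx in neq_ij.
have Zij: (w ^+ j - w ^+ i) / M \in Aint.
  apply: AS; apply/S_P; exists [ffun k => ((c j k - c i k) %/ N.+1%:Z)%Z].
  rewrite !Dc -sumrB mulr_suml; apply: eq_bigr => k _; rewrite ffunE.
  have /dvdzP[z Dz]: (N.+1%:Z %| c j k - c i k)%Z.
    rewrite -eqz_mod_dvd; apply/eqP.
    have /ffunP/(_ k) := Drij; rewrite !ffunE => /(congr1 val) /=.
    have ltN (u : int) : (`|(u %% N.+1%:Z)%Z| < N.+1)%N.
      by rewrite -ltz_nat gez0_abs ?modz_ge0 // ltz_pmod.
    rewrite !inordK ?ltN // => /(congr1 Posz).
    by rewrite !gez0_abs ?modz_ge0.
  rewrite Dz mulzK // -mulrzBr Dz mulrzA -[_ *~ N.+1]mulr_natr mulfK //.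
  by rewrite pnatr_eq0.
pose d := (j - i)%N; have d_gt0: (0 < d)%N by rewrite subn_gt0.
(* [i.+1] rather than [i] keeps the exponent positive when [i] is 0. *)
exists (d * i.+1)%N => [|k k_gt0]; first by rewrite muln_gt0 d_gt0.
have period l n : (i <= n)%N -> (w ^+ (n + d * l) - w ^+ n) / M \in Aint.
  elim: l => [|l IHl] le_in; first by rewrite muln0 addn0 subrr mul0r rpred0.
  rewrite -[w ^+ (n + d * l.+1)%N](subrK (w ^+ (n + d * l)%N)) -addrA mulrDl.
  apply: rpredD; last exact: IHl.
  have le_in2: (i <= n + d * l)%N by rewrite (leq_trans le_in) ?leq_addr.
  have ->: w ^+ (n + d * l.+1)%N = w ^+ (n + d * l - i)%N * w ^+ j.
    rewrite -exprD mulnS; congr (_ ^+ _); have Dd : d = (j - i)%N by [].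
    by move: (d * l)%N le_in2 => dl; lia.
  have ->: w ^+ (n + d * l)%N = w ^+ (n + d * l - i)%N * w ^+ i.
    by rewrite -exprD subnK.
  by rewrite -mulrBr -mulrA; apply: rpredM => //; apply: rpredX.
rewrite -exprM muln2 -addnn -{2}mulnA; apply: period.
apply: leq_trans (leqnSn i) _.
by rewrite -mulnA mulnCA -[X in (X <= _)%N]muln1 leq_mul // muln_gt0 d_gt0.
Qed.

End AlgebraicIntegers.

(** * Factorisations into conjugates of an element *)

Section ClassWords.
Local Open Scope ring_scope.

Definition words (gT : finGroupType) n (K : {set gT}) : {set n.-tuple gT} :=
  [set w : n.-tuple gT | all (mem K) w].

Definition prodw (gT : finGroupType) (w : seq gT) : gT := (\prod_(x <- w) x)%g.

Lemma sum_words0 (gT : finGroupType) (K : {set gT}) (F : seq gT -> algC) :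
  \sum_(w : 0.-tuple gT | w \in words 0 K) F w = F [::].
Proof.
rewrite (big_pred1 [tuple]) // => w; rewrite inE tuple0 /=.
by rewrite eqxx.
Qed.

Lemma sum_wordsS (gT : finGroupType) n (K : {set gT}) (F : seq gT -> algC) :
  \sum_(w : n.+1.-tuple gT | w \in words n.+1 K) F w =
  \sum_(x in K) \sum_(w : n.-tuple gT | w \in words n K) F (x :: w).
Proof.
rewrite pair_big_dep /=.
rewrite (reindex (fun p : gT * n.-tuple gT => [tuple of p.1 :: p.2])) /=.
  by apply: eq_bigl => -[x w]; rewrite !inE.
exists (fun w : n.+1.-tuple gT => (thead w, [tuple of behead w])).
  by move=> [x w] _; congr pair; apply: val_inj.
by move=> w _; rewrite -tuple_eta.
Qed.

(* The value of the central character of ['chi_i] at the class sum of [x ^: G]. *)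
Definition class_mode (gT : finGroupType) (G : {group gT}) (i : Iirr G) x : algC :=
  #|x ^: G|%:R * 'chi_i x / 'chi_i 1%g.

(** The class sum is central, so by Schur's lemma it acts as the scalar [class_mode i x]; multiply
    by the matrix of [g] and take traces. *)
Lemma sum_irr_class_mul (gT : finGroupType) (G : {group gT}) (i : Iirr G) x g :
    x \in G -> g \in G ->
  \sum_(y in x ^: G) 'chi_i (y * g)%g = class_mode i x * 'chi_i g.
Proof.
move=> Gx Gg; have clGxG := mem_classes Gx; pose k := enum_rank_in clGxG (x ^: G).
have Dk: enum_val k = x ^: G by rewrite enum_rankK_in.
have k_x: x \in enum_val k by rewrite Dk class_refl.
rewrite /class_mode -(gring_mode_class_sum_eq i k_x).
have := irr_gring_center i (gring_class_sum_central algC k).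
move/(congr1 (fun A => \tr (A *m irr_repr (socle_of_Iirr i) g))).
rewrite mul_scalar_mx mxtraceZ.
have trE h: h \in G -> \tr (irr_repr (socle_of_Iirr i) h) = 'chi_i h.
  by move=> Gh; rewrite -irrRepr cfunE Gh.
rewrite trE // => <-.
rewrite /gring_class_sum /gset_mx raddf_sum mulmx_suml raddf_sum Dk /=.
apply: eq_bigr => y /imsetP[u Gu ->].
by rewrite gring_opG ?groupJ // -repr_mxM ?groupJ // trE // groupM ?groupJ.
Qed.

Lemma sum_irr_words (gT : finGroupType) (G : {group gT}) (i : Iirr G) x g n :
    x \in G -> g \in G ->
  \sum_(w : n.-tuple gT | w \in words n (x ^: G)) 'chi_i (prodw w * g)%g
    = class_mode i x ^+ n * 'chi_i g.
Proof.
move=> Gx; elim: n g => [|n IHn] g Gg.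
  by rewrite (sum_words0 _ (fun w => 'chi_i (prodw w * g)%g)) /prodw big_nil mul1g mul1r.
rewrite (sum_wordsS _ _ (fun w => 'chi_i (prodw w * g)%g)) exchange_big /=.
transitivity (\sum_(w : n.-tuple gT | w \in words n (x ^: G))
                class_mode i x * 'chi_i (prodw w * g)%g).
  apply: eq_bigr => w; rewrite inE => /allP Kw.
  have Gw: prodw w \in G.
    rewrite /prodw big_seq; apply: group_prod => y /Kw.
    by apply/subsetP; rewrite class_subG.
  rewrite -sum_irr_class_mul ?groupM //.
  by apply: eq_bigr => y _; rewrite /prodw big_cons mulgA.
by rewrite -mulr_sumr IHn // exprS mulrA.
Qed.

Definition class_words (gT : finGroupType) n (G : {group gT}) (x t : gT) :=
  [set w : n.-tuple gT in words n (x ^: G) | prodw w \in t ^: G].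

(** Frobenius' formula. The regular character at [prodw w * s^-1] tests whether [prodw w = s];
    summing over [s] in the class of [t] and expanding into irreducible characters reduces the count
    to [sum_irr_words]. *)
Lemma card_class_words (gT : finGroupType) n (G : {group gT}) x t :
    x \in G -> t \in G ->
  (#|class_words n G x t| * #|'C_G[t]|)%:R
    = \sum_(i : Iirr G) 'chi_i 1%g * 'chi_i t^-1%g * class_mode i x ^+ n.
Proof.
move=> Gx Gt.
have nzG := neq0CG G.
have sum_reg g : g \in G ->
    \sum_(i : Iirr G) 'chi_i 1%g * 'chi_i g = #|G|%:R *+ (g == 1%g).
  move=> Gg; rewrite -cfRegE cfReg_sum sum_cfunE.
  by apply: eq_bigr => i _; rewrite !cfunE.
have wG w : w \in words n (x ^: G) -> prodw w \in G.
  rewrite inE => /allP Kw; rewrite /prodw big_seq; apply: group_prod => y /Kw.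
  by apply/subsetP; rewrite class_subG.
apply: (mulfI nzG).
transitivity (#|'C_G[t]|%:R * \sum_(w : n.-tuple gT | w \in words n (x ^: G))
     \sum_(s in t ^: G) \sum_(i : Iirr G) 'chi_i 1%g * 'chi_i (prodw w * s^-1)%g).
  rewrite natrM mulrA mulrC; congr (_ * _).
  rewrite -[#|class_words _ _ _ _|]sum1_card natr_sum mulr_sumr.
  rewrite big_mkcond /= [RHS]big_mkcond /=.
  apply: eq_bigr => w _; rewrite [w \in class_words _ _ _ _]inE.
  have [Kw | //] := boolP (w \in words _ _).
  have Gs s : s \in t ^: G -> s \in G by apply/subsetP; rewrite class_subG.
  transitivity (\sum_(s in t ^: G) #|G|%:R *+ (prodw w == s) : algC); last first.
    apply: eq_bigr => s tGs; rewrite sum_reg ?groupM ?groupV ?wG ?Gs //.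
    by rewrite -eq_mulgV1.
  have [tGw | tG'w] /= := boolP (prodw w \in t ^: G).
    rewrite (bigD1 (prodw w)) //= eqxx big1 ?addr0 ?mulr1 // => s /andP[_].
    by rewrite eq_sym => /negPf->.
  rewrite big1 // => s tGs; rewrite (_ : _ == s = false) //.
  by apply: contraNF tG'w => /eqP->.
transitivity (#|'C_G[t]|%:R * \sum_(s in t ^: G) \sum_(i : Iirr G)
     'chi_i 1%g * ('chi_i t^-1%g * class_mode i x ^+ n)).
  congr (_ * _); rewrite exchange_big; apply: eq_bigr => s /imsetP[u Gu ->] /=.
  rewrite exchange_big; apply: eq_bigr => i _ /=; rewrite -mulr_sumr.
  by rewrite sum_irr_words ?groupV ?groupJ // -conjVg cfunJ // [_ * 'chi_i _]mulrC.
rewrite sumr_const -[_ *+ #|_ ^: _|]mulr_natl mulrA -natrM -index_cent1 Lagrange ?subsetIl //.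
by congr (_ * _); apply: eq_bigr => i _; rewrite mulrA.
Qed.

End ClassWords.

Lemma class_wordsE (gT : finGroupType) n (G : {group gT}) x t (w : n.-tuple gT) :
  (w \in class_words n G x t) = all (mem (x ^: G)) w && (prodw w \in t ^: G).
Proof. by rewrite !inE. Qed.

Lemma prodw_cat (gT : finGroupType) (u v : seq gT) : prodw (u ++ v) = prodw u * prodw v.
Proof. exact: big_cat. Qed.

(** Comparing initial segments shows that [v] starts with [u]; cancelling and iterating, [v] is [u]
    repeated [k] times. *)
Lemma prodw_commuting_word (gT : finGroupType) (u v : seq gT) k :
  size v = (k * size u)%N -> u ++ v = v ++ u -> prodw v = prodw u ^+ k.
Proof.
elim: k v => [|k IHk] v; first by move/size0nil->; rewrite /prodw big_nil expg0.
rewrite mulSn => sz_v uv_vu.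
have def_u: take (size u) v = u.
  have := congr1 (take (size u)) uv_vu; rewrite take_size_cat // take_cat sz_v.
  case: ltnP => [_ <- // | le_vu].
  rewrite (_ : size u - _ = 0)%N; last by apply/eqP; rewrite subn_eq0 leq_addr.
  by rewrite take0 cats0 => ->; rewrite take_oversize.
rewrite -(cat_take_drop (size u) v) def_u prodw_cat (IHk (drop (size u) v)).
- by rewrite expgS.
- by rewrite size_drop sz_v addKn.
have := uv_vu; rewrite -{1 2}(cat_take_drop (size u) v) def_u -catA.
by move/eqP; rewrite eqseq_cat // eqxx /= => /eqP.
Qed.

Lemma iter_rot (T : Type) m k (s : seq T) :
  (k * m <= size s)%N -> iter k (seq.rot m) s = seq.rot (k * m) s.
Proof.
elim: k => [|k IHk]; first by rewrite rot0.
move=> le_s; rewrite iterS IHk ?rotD // ?mulSn //.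
  by apply: leq_trans le_s; rewrite leq_mul.
Qed.

(* The cyclic group generated by the rotation by [m] has order dividing a power of
   p; a word in a short orbit is a power [u ^ (p ^ k)] with [p ^ k] at least
   [#|G|`_p], so its product is p-regular and not conjugate to [t]. *)
Lemma class_words_dvd (gT : finGroupType) n m L p (G : {group gT}) (x t : gT) :
    prime p -> x \in G -> t \in G -> p.-elt t -> t != 1 ->
    n = (m * p ^ (L + logn p #|G|))%N ->
  (p ^ L %| #|class_words n G x t|)%N.
Proof.
move=> pr_p Gx Gt p_t nt_t Dn.
have wG w : w \in class_words n G x t -> all (mem G) w.
  rewrite class_wordsE => /andP[/allP Kw _]; apply/allP => y /Kw.
  by apply/subsetP; rewrite class_subG.
have prodG (w : seq gT) : all (mem G) w -> prodw w \in G.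
  by move/allP=> Gw; rewrite /prodw big_seq; apply: group_prod.
pose rotm (w : n.-tuple gT) := [tuple of seq.rot m w].
have rotm_inj: injective rotm.
  by move=> u v /(congr1 val)/= /rot_inj/val_inj.
pose r := perm rotm_inj; pose X := class_words n G x t.
have Er k w : val (iter k r w) = iter k (seq.rot m) w.
  by elim: k => //= k <-; rewrite permE.
set j := (L + logn p #|G|)%N in Dn.
have r_ord: (#[r] %| p ^ j)%N.
  rewrite order_dvdn; apply/eqP/permP => w; apply: val_inj.
  rewrite permX Er perm1 iter_rot; first last.
    by rewrite size_tuple mulnC -Dn.
  rewrite mulnC -Dn.
  by rewrite rot_oversize // size_tuple.
(* Rotation turns a product [u * v] into its conjugate [v * u], hence preserves [X]. *)
have actsX: [acts <[r]>, on X | 'P].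
  rewrite cycle_subG !inE /=; apply/subsetP=> w Xw.
  rewrite inE /= apermE permE class_wordsE /=.
  have Gw := wG w Xw; move: (Xw); rewrite class_wordsE => /andP[Kw].
  rewrite (eq_all_r (mem_rot m w)) Kw -{1}(cat_take_drop m w) /seq.rot !prodw_cat /=.
  set u := prodw (take m w); set v := prodw _ => tGuv.
  have Gu: u \in G.
    by apply: prodG; move: Gw; rewrite -{1}(cat_take_drop m w) all_cat => /andP[].
  have ->: v * u = (u * v) ^ u by rewrite conjgE -!mulgA mulKg.
  by rewrite -(class_eqP tGuv) memJ_class.
rewrite -[#|_|](acts_sum_card_orbit actsX); apply: dvdn_sum => _ /imsetP[w Xw ->].
have -> : orbit 'P%act <[r]> w = porbit r w.
  by rewrite porbitE.
set d := #|porbit r w|.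
have d_dv: (d %| p ^ j)%N.
  by apply: dvdn_trans r_ord; rewrite /d porbitE dvdn_orbit.
have /(dvdn_pfactor _ _ pr_p)[i le_ij Dd] := d_dv; rewrite Dd.
apply: dvdn_exp2l; rewrite leqNgt; apply/negP => lt_iL.
have := iter_porbit r w; rewrite -/d => /(congr1 val); rewrite Er.
rewrite iter_rot; last first.
  by rewrite size_tuple Dn mulnC leq_mul // dvdn_leq ?expn_gt0 ?prime_gt0.
set D := (d * m)%N => rotD_w; set u := take D w; set v := drop D w.
have Duv: u ++ v = v ++ u.
  by rewrite cat_take_drop -[LHS]rotD_w /seq.rot.
have [m0 | m_gt0] := posnP m.
  have sz_w: size w = 0%N by rewrite size_tuple Dn m0.
  have := Xw; rewrite class_wordsE (size0nil sz_w) /prodw big_nil /= class_sym => /imsetP[y _].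
  by rewrite conj1g => /eqP; rewrite (negPf nt_t).
have Dnd: n = (D * p ^ (j - i))%N.
  by rewrite Dn /D Dd mulnAC mulnC -expnD subnKC.
have sz_u: size u = D.
  by rewrite size_takel // size_tuple Dnd leq_pmulr // expn_gt0 prime_gt0.
have pr_uv: prodw w = prodw u ^+ (p ^ (j - i)).
  rewrite -(cat_take_drop D w) prodw_cat.
  rewrite (@prodw_commuting_word _ u v (p ^ (j - i)).-1) //.
    by rewrite -expgS prednK // expn_gt0 prime_gt0.
  by rewrite size_drop size_tuple sz_u Dnd -subn1 mulnBl mul1n mulnC.
have Gu: prodw u \in G.
  apply: prodG; move: (wG w Xw); rewrite -{1}(cat_take_drop D w) all_cat.
  by case/andP.
have p'u: p^'.-elt (prodw w).
  rewrite pr_uv.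
  have ->: (j - i = logn p #|G| + (L - i))%N by rewrite addnC addnBAC // ltnW.
  rewrite expnD expgM; apply: p_eltX.
  have Go := order_dvdG Gu.
  rewrite -(consttC p (prodw u)) expgMn; last exact: (commuteX2 _ _ (commute_refl _)).
  have ->: (prodw u).`_p ^+ (p ^ logn p #|G|) = 1.
    apply/eqP; rewrite -order_dvdn order_constt p_part.
    by apply: dvdn_exp2l; apply: dvdn_leq_log.
  by rewrite mul1g; apply/p_eltX/p_elt_constt.
have: p.-elt (prodw w).
  by have := Xw; rewrite class_wordsE => /andP[_ /imsetP[y _ ->]]; rewrite p_eltJ.
move/pnat_1/(_ p'u)/eqP; rewrite order_eq1 => /eqP w1.
have := Xw; rewrite class_wordsE w1 class_sym => /andP[_ /imsetP[y _]].
by rewrite conj1g => /eqP; rewrite (negPf nt_t).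
Qed.

(** * Classes of prime power size *)

Section PrimePowerClass.
Local Open Scope ring_scope.

(** All conjugates of [x] have the same image in the abelian quotient. *)
Lemma quotient_der1_class_gen gT (G : {group gT}) x :
  <<x ^: G>> = G -> (G / G^`(1) = <[x]> / G^`(1))%g.
Proof.
move=> genG; have Gx: x \in G by rewrite -genG mem_gen ?class_refl.
have nG'G := der_norm 1 G.
have nG'x: <[x]> \subset 'N(G^`(1)) by rewrite cycle_subG (subsetP nG'G).
apply/eqP; rewrite eqEsubset [X in _ && X]quotientS ?cycle_subG // andbT.
suff: (<<x ^: G>> / G^`(1) \subset <[x]> / G^`(1))%g by rewrite genG.
rewrite quotient_gen; last by rewrite (subset_trans _ nG'G) ?class_subG.
rewrite gen_subG; apply/subsetP=> _ /morphimP[_ _ /imsetP[g Gg ->] ->] /=.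
have Nx := subsetP nG'G x Gx.
have -> : coset G^`(1) (x ^ g) = coset G^`(1) x.
  have cGG: abelian (G / G^`(1)) := der_abelian 0 G.
  rewrite morphJ ?(subsetP nG'G) //; apply/conjg_fixP/commgP.
  by apply: (centsP cGG); rewrite mem_quotient.
by rewrite mem_quotient ?cycle_id.
Qed.

(** ['Z('chi_i)] is normal, so with [x] it contains all of [G]; then [G] modulo the kernel of
    ['chi_i] is its own centre, hence abelian. *)
Lemma irr_cfcenter_full gT (G : {group gT}) i x :
  <<x ^: G>> = G -> x \in ('Z('chi[G]_i))%CF -> 'chi_i \is a linear_char.
Proof.
move=> genG Zx; have defZ: ('Z('chi_i))%CF = G.
  apply/eqP; rewrite eqEsubset cfcenter_sub -{1}genG gen_subG.
  rewrite class_sub_norm ?Zx //.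
  by case/andP: (cfcenter_normal 'chi_i).
rewrite lin_irr_der1 der1_min ?cfker_norm //.
have := cfcenter_eq_center i; rewrite defZ => ->.
exact: center_abelian.
Qed.

Lemma class_gen_der1_p' gT (G : {group gT}) (p q : nat) x :
    prime p -> prime q -> p != q -> p.-elt x -> q.-nat #|x ^: G| ->
  <<x ^: G>> = G -> p^'.-group G^`(1).
Proof.
move=> pr_p pr_q neq_pq p_x q_xG genG.
have Gx: x \in G by rewrite -genG mem_gen ?class_refl.
apply: contraT => p_dvd_G'.
have{p_dvd_G'} /Cauchy[//|t G't ot]: (p %| #|G^`(1)%g|)%N.
  by apply: contraR p_dvd_G' => ?; rewrite /pgroup p'natE.
have Gt: t \in G := subsetP (der_sub 1 G) t G't.
have p_t: p.-elt t by rewrite /p_elt ot pnat_id.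
have nt_t: t != 1%g by rewrite -order_gt1 ot prime_gt1.
pose lin i := 'chi[G]_i \is a linear_char.
pose c : algC := \sum_(i | lin i) 'chi[G]_i 1%g * 'chi_i t^-1%g.
pose a i : algC := 'chi[G]_i 1%g * 'chi_i t^-1%g.
pose s := [seq i <- enum (Iirr G) | ~~ lin i & (q %| 'chi_i 1%g)%C].
have nzq: q%:R != 0 :> algC by rewrite pnatr_eq0 -lt0n prime_gt0.
have lin_t i : lin i -> 'chi_i 1%g * 'chi_i t^-1%g = 1.
  move=> Li; rewrite lin_char1 // mul1r.
  have: t^-1%g \in cfker 'chi_i.
    by rewrite groupV (subsetP _ t G't) // -lin_irr_der1.
  by move/cfker1->; rewrite lin_char1.
have Dc: c = #|G : G^`(1)|%:R.
  by rewrite /c (eq_bigr (fun=> 1)) // sumr_const -card_lin_irr.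
have Zc: c \in Aint by rewrite Dc Aint_Cnat.
(* The abelianisation of [G] is generated by the image of [x], so its order [c] is a power of
   [p]. *)
have q'c: c / q%:R \notin Aint.
  apply/negP=> Zcq; have: c / q%:R \in Num.int.
    by apply: Cint_rat_Aint Zcq; rewrite Dc rpred_div ?rpred_nat.
  have p_GG': p.-nat #|G : G^`(1)|.
    rewrite -card_quotient ?der_norm // (quotient_der1_class_gen genG).
    exact: quotient_pgroup.
  move=> Zc'; have: (q %| c)%C by rewrite unfold_in (negPf nzq).
  rewrite Dc dvdC_nat => /(pnat_dvd)/(_ p_GG').
  by rewrite pnatE // inE eq_sym (negPf neq_pq).
have Za: {in s, forall i, a i \in Aint /\ a i / q%:R \in Aint}.
  move=> i; rewrite mem_filter => /andP[/andP[_ /dvdCP[z Zz Dz]] _].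
  have Zaz: z * 'chi_i t^-1%g \in Aint by rewrite rpredM ?Aint_irr ?Aint_Cint.
  rewrite /a Dz; split; last by rewrite -mulrA mulrCA mulrC mulfK.
  by rewrite -mulrA mulrCA rpredM ?rpred_nat.
have [D [ZD nzD hD]] := Aint_idempotent_sum Zc q'c Za.
(* It remains to show that [p ^ L] divides [D], contrary to the choice of [L]. *)
have [L /negP[]] := Aint_pfactor_bound (prime_gt1 pr_p) ZD nzD.
have pL_gt0: (0 < p ^ L)%N by rewrite expn_gt0 prime_gt0.
set M : algC := (p ^ L)%:R.
have Zw (i : Iirr G) : class_mode i x \in Aint by apply: (Aint_class_div_irr1 i Gx).
have /fin_all_exists2[ni ni_gt0 hni] : forall i : Iirr G, exists2 n, (0 < n)%N &
    forall k, (0 < k)%N ->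
     ((class_mode i x ^+ (n * k)) ^+ 2 - class_mode i x ^+ (n * k)) / M \in Aint.
  by move=> i; apply: Aint_exp_idempotent.
(* In the exponent [n], the factor [#|G|] trivialises the values of linear characters at [x], the
   [ni i] make the modes idempotent modulo [M], and the power of [p] serves [class_words_dvd]. *)
pose m := (#|G| * \prod_i ni i)%N.
pose n := (m * p ^ (L + logn p #|G|))%N.
have m_gt0: (0 < m)%N by rewrite muln_gt0 cardG_gt0 prodn_gt0.
have n_gt0: (0 < n)%N by rewrite muln_gt0 m_gt0 expn_gt0 prime_gt0.
have idem (i : Iirr G) : ((class_mode i x ^+ n) ^+ 2 - class_mode i x ^+ n) / M \in Aint.
  have /dvdnP[k Dk]: (ni i %| n)%N.
    by rewrite dvdn_mulr // dvdn_mull // (bigD1 i) //= dvdn_mulr.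
  rewrite Dk mulnC; apply: hni.
  by move: n_gt0; rewrite Dk muln_gt0 => /andP[].
have lin_w i : lin i -> (class_mode i x ^+ n - 1) / M \in Aint.
  move=> Li; have := idem i; rewrite /class_mode lin_char1 // divr1 exprMn.
  have -> : 'chi_i x ^+ n = 1.
    rewrite -lin_charX // -[RHS](lin_char1 Li); congr ('chi_i _); apply/eqP.
    rewrite -order_dvdn (dvdn_trans (order_dvdG Gx)) //.
    by rewrite dvdn_mulr ?dvdn_mulr.
  rewrite mulr1; set k := #|x ^: G|; rewrite -natrX.
  have kn_gt0: (0 < k ^ n)%N by rewrite expn_gt0 /k -index_cent1 indexg_gt0.
  have -> : ((k ^ n)%:R ^+ 2 - (k ^ n)%:R : algC) = (k ^ n * (k ^ n - 1))%:R.
    by rewrite natrM natrB // mulrBr mulr1 expr2.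
  move=> Zk.
  have nzM: M != 0 by rewrite pnatr_eq0 -lt0n.
  have : ((p ^ L)%N %| (k ^ n * (k ^ n - 1))%N)%C.
    by rewrite unfold_in (negPf nzM) Cint_rat_Aint // rpred_div ?rpred_nat.
  rewrite dvdC_nat Gauss_dvdr; last first.
    rewrite coprimeXl // coprimeXr //; apply: (pnat_coprime (pi := p)).
      by rewrite pnat_id.
    by apply: sub_in_pnat q_xG => r _; rewrite !inE => /eqP->; rewrite eq_sym.
  rewrite -[1]/1%:R -natrB //; case/dvdnP=> z ->.
  by rewrite natrM mulfK // rpred_nat.
(* Burnside: a degree coprime to the class size forces ['chi_i x = 0] unless [x] lies in
   ['Z('chi_i)], which would make ['chi_i] linear. *)
have w0 i : ~~ lin i -> ~~ (q %| 'chi_i 1%g)%C -> class_mode i x = 0.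
  move=> nLi q'i; rewrite /class_mode coprime_degree_support_cfcenter ?mulr0 ?mul0r //.
    rewrite irr1_degree natrK; rewrite irr1_degree dvdC_nat in q'i.
    rewrite coprime_sym (@pnat_coprime q) // p'natE //.
  by apply: contra nLi; apply: irr_cfcenter_full.
have X_dvd := class_words_dvd pr_p Gx Gt p_t nt_t (erefl n).
have := card_class_words n Gx Gt.
rewrite (bigID lin) /= [X in _ + X](bigID (fun i => q %| 'chi[G]_i 1%g)%C) /=.
rewrite [X in _ + (_ + X)]big1 ?addr0; last first.
  by move=> i /andP[nLi q'i]; rewrite w0 // expr0n gtn_eqF // mulr0.
move=> Dsum.
rewrite -[D]mul1r; apply: (hD M (fun i => class_mode i x ^+ n)) => //.
  by move=> i _; rewrite rpredX.
have -> : \sum_(i <- s) a i * class_mode i x ^+ n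
   = \sum_(i | ~~ lin i && (q %| 'chi_i 1%g)%C)
       'chi_i 1%g * 'chi_i t^-1%g * class_mode i x ^+ n.
  by rewrite /s big_filter big_enum_cond.
(* Replacing [c] by the linear part of Frobenius' sum costs an error divisible by [M], by [lin_w];
   the full sum is divisible by [M] by [X_dvd]. *)
have -> : c = \sum_(i | lin i) 'chi_i 1%g * 'chi_i t^-1%g * class_mode i x ^+ n
     - \sum_(i | lin i) (class_mode i x ^+ n - 1).
  by rewrite -sumrB; apply: eq_bigr => i Li; rewrite lin_t // mul1r opprB addrC subrK.
rewrite mul1r addrAC -Dsum mulrBl rpredB //.
  case/dvdnP: X_dvd => z ->; rewrite mulnAC natrM mulfK ?Aint_Cnat //.
  by rewrite pnatr_eq0 -lt0n.
by rewrite mulr_suml rpred_sum.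
Qed.

End PrimePowerClass.

(** [#|x ^: H|] is also the index of ['C_G[x]] in the subgroup ['C_G[x] <*> H] of [G]. *)
Lemma class_normal_dvd (gT : finGroupType) (G H : {group gT}) x :
  H <| G -> (#|x ^: H| %| #|x ^: G|)%N.
Proof.
move=> /andP[sHG nHG]; rewrite -!index_cent1.
have nHC : 'C_G[x] \subset 'N(H) by rewrite subIset ?nHG.
rewrite -[X in (X %| _)%N](_ : #|'C_G[x] <*> H : 'C_G[x]| = _).
  by apply: indexSg; rewrite ?joing_subl // join_subG subsetIl.
by rewrite norm_joinEl // indexMg -indexgI setIA (setIidPl sHG).
Qed.

Lemma pseries2_max (gT : finGroupType) (pi1 pi2 : nat_pred) (G N : {group gT}) :
  N <| G -> pi2.-group (N / 'O_pi1(G)) -> N \subset 'O_{pi1, pi2}(G).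
Proof.
move=> nsNG pi2N; have nON: N \subset 'N('O_pi1(G)).
  by rewrite (subset_trans (normal_sub nsNG)) ?gFnorm.
rewrite -(quotientSGK nON); last first.
  by have := pseries_sub_catl [:: pi1] [:: pi2] G; rewrite pseries1.
by rewrite quotient_pseries2 pcore_max ?quotient_normal.
Qed.

Lemma pseries2_pgroup_quotient (gT : finGroupType) (pi1 pi2 : nat_pred) (G K : {group gT}) :
  'O_pi1(G) \subset K -> 'O_{pi1, pi2}(G) \subset 'N(K) ->
  pi2.-group ('O_{pi1, pi2}(G) / K).
Proof.
move=> sOK nK; rewrite /pgroup card_quotient //.
apply: pnat_dvd (indexgS _ sOK) _.
rewrite -card_quotient; last by rewrite (subset_trans (pseries_sub _ _)) ?gFnorm.
rewrite quotient_pseries2; exact: pcore_pgroup.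
Qed.

Lemma normal_pseries2_sub (gT : finGroupType) (pi1 pi2 : nat_pred) (G H : {group gT}) :
  H <| G -> 'O_{pi1, pi2}(H) \subset 'O_{pi1, pi2}(G).
Proof.
move=> nsHG; apply: pseries2_max; first exact: gFnormal_trans.
apply: pseries2_pgroup_quotient.
  by rewrite pcore_max ?pcore_pgroup ?gFnormal_trans.
by rewrite (subset_trans (pseries_sub _ _)) ?(subset_trans (normal_sub nsHG)) ?gFnorm.
Qed.

Lemma coprime_class_mulG (gT : finGroupType) (G H : {group gT}) x :
  x \in G -> H \subset G -> coprime #|x ^: G| #|G : H| -> 'C_G[x] * H = G.
Proof.
by move=> Gx sHG; rewrite -index_cent1; apply: coprime_index_mulG; rewrite ?subsetIl.
Qed.

Lemma cent_coprime_class_mulG (gT : finGroupType) (q : nat) (G Q : {group gT}) x :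
  x \in G -> q.-Sylow(G) Q -> q.-nat #|x ^: G| -> 'C_G[x] * Q = G.
Proof.
move=> Gx /and3P[sQG qQ q'GQ] qxG.
by apply: coprime_class_mulG; rewrite // (pnat_coprime qxG).
Qed.

Lemma class_pnat_pcore (gT : finGroupType) (p : nat) (G : {group gT}) x :
  x \in G -> p.-elt x -> p.-nat #|x ^: G| -> x \in 'O_p(G).
Proof.
move=> Gx p_x pxG; have sxG: <[x]> \subset G by rewrite cycle_subG.
have [Q sylQ sxQ] := Sylow_superset sxG p_x.
have Qx: x \in Q by rewrite -cycle_subG.
have sKQ: <<x ^: G>> \subset Q.
  rewrite gen_subG; apply/subsetP=> _ /imsetP[g Gg ->].
  move: Gg; rewrite -(cent_coprime_class_mulG Gx sylQ pxG).
  case/mulsgP=> c u /setIP[_ /cent1P cx] Qu ->.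
  by rewrite conjgM (conjgE x c) -cx mulKg groupJ.
have sKO: <<x ^: G>> \subset 'O_p(G).
  apply: pcore_max; first exact: pgroupS sKQ (pHall_pgroup sylQ).
  by rewrite /normal gen_subG class_subG // norms_gen ?class_norm.
by rewrite (subsetP sKO) ?mem_gen ?class_refl.
Qed.

Lemma class_gen_pseries2 (gT : finGroupType) (p q : nat) (G : {group gT}) x :
    prime p -> prime q -> p != q -> p.-elt x -> q.-nat #|x ^: G| ->
  <<x ^: G>> = G -> G \subset 'O_{q, p}(G).
Proof.
move=> pr_p pr_q neq_pq p_x q_xG genG.
have p'G' := class_gen_der1_p' pr_p pr_q neq_pq p_x q_xG genG.
have Gx: x \in G by rewrite -genG mem_gen ?class_refl.
have sxG: <[x]> \subset G by rewrite cycle_subG.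
have nG'x: <[x]> \subset 'N(G^`(1)) := subset_trans sxG (der_norm 1 G).
have coG'x: coprime #|G^`(1)| #|<[x]>|.
  by rewrite coprime_sym (pnat_coprime p_x).
have [Q sylQ nQx] :=
  sol_coprime_Sylow_exists q (abelian_sol (cycle_abelian x)) nG'x coG'x.
have sQG: Q \subset G := subset_trans (pHall_sub sylQ) (der_sub 1 G).
(* [Q] is Sylow in [G] too, because the abelianisation of [G] is a p-group and [q] differs from
   [p]. *)
have sylQG: q.-Sylow(G) Q.
  rewrite /pHall sQG (pHall_pgroup sylQ) -(Lagrange_index (der_sub 1 G) (pHall_sub sylQ)).
  rewrite pnatM; case/and3P: sylQ => _ _ ->; rewrite andbT.
  rewrite -card_quotient ?der_norm // (quotient_der1_class_gen genG).
  apply: (pi_pnat (quotient_pgroup _ p_x)).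
  by rewrite !inE.
have defG := cent_coprime_class_mulG Gx sylQG q_xG.
(* As ['C_G[x] * Q = G], every conjugate of [x] is a conjugate by an element of [Q]. *)
have sGQx: G \subset Q <*> <[x]>.
  rewrite -{1}genG gen_subG; apply/subsetP=> _ /imsetP[g Gg ->].
  move: Gg; rewrite -defG => /mulsgP[c u /setIP[_ /cent1P cx] Qu ->].
  rewrite conjgM (conjgE x c) -cx mulKg groupJ //.
    by rewrite (subsetP (joing_subr _ _)) ?cycle_id.
  by rewrite (subsetP (joing_subl _ _)).
have nsQG: Q <| G.
  by rewrite /normal sQG (subset_trans sGQx) // join_subG normG.
have sQO: Q \subset 'O_q(G) by rewrite pcore_max ?(pHall_pgroup sylQ).
apply: pseries2_max => //.
have nOQ: Q \subset 'N('O_q(G)) := subset_trans sQG (gFnorm _ _).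
have nOx: <[x]> \subset 'N('O_q(G)) := subset_trans sxG (gFnorm _ _).
apply: pgroupS (quotientS _ sGQx) _.
by rewrite /= quotientY // (quotientS1 sQO) joing1G quotient_pgroup.
Qed.

(* For p-elements this refines Kazarin's theorem that a class of prime power size
   generates a soluble subgroup. *)
Theorem prime_power_class_pseries2 (gT : finGroupType) (p q : nat) (G : {group gT}) x :
    prime p -> prime q -> x \in G -> p.-elt x -> q.-nat #|x ^: G| ->
  x \in 'O_{q, p}(G).
Proof.
move=> pr_p pr_q; have [n] := ubnP #|G|; elim: n G => // n IHn G /ltnSE-leGn Gx p_x q_xG.
have sHG: <<x ^: G>> \subset G by rewrite gen_subG class_subG.
have nsHG: <<x ^: G>> <| G.
  by rewrite /normal sHG norms_gen ?class_norm.
have Hx: x \in <<x ^: G>> by rewrite mem_gen ?class_refl.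
have [eq_pq | neq_pq] := eqVneq p q.
  have := pseries_sub_catl [:: q : nat_pred] [:: p : nat_pred] G.
  rewrite pseries1 => /subsetP; apply; rewrite -eq_pq in q_xG *.
  exact: class_pnat_pcore.
have [eqHG | ltHG] := eqVproper sHG.
  by rewrite (subsetP (class_gen_pseries2 pr_p pr_q neq_pq p_x q_xG eqHG)).
apply: (subsetP (normal_pseries2_sub _ _ nsHG)); apply: IHn => //.
  exact: leq_trans (proper_card ltHG) leGn.
exact: pnat_dvd (class_normal_dvd _ nsHG) q_xG.
Qed.

(** * Factorised groups *)

(** A Sylow subgroup of [G] containing one of [A] contains a conjugate by some [b * a] of one of
    [B]; undoing [a] on the first two and keeping [b] on the last leaves each in its factor. Since
    [PA :&: PB] is a p-subgroup of [A :&: B], comparing orders gives equality. *)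
Lemma factorised_Sylow_exists (gT : finGroupType) (p : nat) (G A B : {group gT}) :
    A * B = G ->
  exists PA PB P : {group gT},
    [/\ p.-Sylow(A) PA, p.-Sylow(B) PB, p.-Sylow(G) P & PA * PB = P].
Proof.
move=> defG; have sAG: A \subset G by rewrite -defG mulG_subl.
have sBG: B \subset G by rewrite -defG mulG_subr.
have [PA0 sylPA0] := Sylow_exists p A; have [PB0 sylPB0] := Sylow_exists p B.
have [P1 sylP1 sPA01] :=
  Sylow_superset (subset_trans (pHall_sub sylPA0) sAG) (pHall_pgroup sylPA0).
have [x Gx sPB01] :=
  Sylow_Jsub sylP1 (subset_trans (pHall_sub sylPB0) sBG) (pHall_pgroup sylPB0).
have defG' : B * A = G.
  by rewrite -defG; apply/esym/comm_group_setP; rewrite defG groupP.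
have /mulsgP[b a Bb Aa Dx]: x \in B * A by rewrite defG'.
pose PA := (PA0 :^ a^-1)%G; pose PB := (PB0 :^ b)%G; pose P := (P1 :^ a^-1)%G.
have sylPA: p.-Sylow(A) PA by rewrite pHallJ ?groupV.
have sylPB: p.-Sylow(B) PB by rewrite pHallJ.
have sylP: p.-Sylow(G) P by rewrite pHallJ ?groupV ?(subsetP sAG).
exists PA, PB, P; split=> //; apply/eqP; rewrite eqEcard mul_subG ?conjSg //=; last first.
  by rewrite -sub_conjgV invgK -conjsgM -Dx.
rewrite -(leq_pmul2r (cardG_gt0 (PA :&: PB))) -mul_cardG.
rewrite (card_Hall sylP) (card_Hall sylPA) (card_Hall sylPB).
rewrite -partnM // mul_cardG defG partnM // leq_mul2l; apply/orP; right.
apply: dvdn_leq; first exact: part_gt0.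
rewrite -(part_pnat_id (pgroupS (subsetIl PA PB) (pHall_pgroup sylPA))).
by rewrite partn_dvd // cardSg // setISS ?(pHall_sub sylPA) ?(pHall_sub sylPB).
Qed.

(** * Products of elements whose classes have coprime sizes *)

(** Writing [g * h^-1 = c * d] with [c] centralising [x] and [d] centralising [y] makes [d * h] a
    common conjugator. *)
Lemma class_mul_coprime (gT : finGroupType) (G : {group gT}) x y g h :
    x \in G -> y \in G -> coprime #|x ^: G| #|y ^: G| -> g \in G -> h \in G ->
  x ^ g * y ^ h \in (x * y) ^: G.
Proof.
move=> Gx Gy co_xy Gg Gh.
have defG: 'C_G[x] * 'C_G[y] = G.
  by rewrite (coprime_class_mulG Gx) ?subsetIl ?index_cent1.
have: g * h^-1 \in G by rewrite groupM ?groupV.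
rewrite -{1}defG => /mulsgP[c d /setIP[Gc /cent1P cx] /setIP[Gd /cent1P dy] Dgh].
have -> : g = c * (d * h) by rewrite mulgA -Dgh mulgKV.
have Dy : y ^ h = y ^ (d * h).
  by rewrite conjgM; congr (_ ^ h); rewrite conjgE -dy mulKg.
rewrite Dy conjgM (_ : x ^ c = x); last by rewrite conjgE -cx mulKg.
by rewrite -conjMg imset_f // groupM.
Qed.

(** The intersection of the two centralisers centralises [x * y], and by coprimality its index is
    the product of the class sizes. *)
Lemma card_class_mul_dvd (gT : finGroupType) (G : {group gT}) x y :
    x \in G -> y \in G -> coprime #|x ^: G| #|y ^: G| ->
  (#|(x * y)%g ^: G| %| #|x ^: G| * #|y ^: G|)%N.
Proof.
move=> Gx Gy co_xy.
have defG: 'C_G[x] * 'C_G[y] = G.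
  by rewrite (coprime_class_mulG Gx) ?subsetIl ?index_cent1.
have sC: 'C_G[x] :&: 'C_G[y] \subset 'C_G[(x * y)%g].
  apply/subsetP=> c /setIP[/setIP[Gc /cent1P cx] /setIP[_ /cent1P cy]].
  by rewrite inE Gc; apply/cent1P; red; rewrite mulgA cx -mulgA cy mulgA.
rewrite -!index_cent1; apply: dvdn_trans (indexgS _ sC) _.
rewrite -(Lagrange_index (subsetIl G 'C[x]) (subsetIl _ _)) dvdn_mul //.
rewrite indexgI; have := indexMg 'C_G[y] 'C_G[x]%g.
have comC: commute 'C_G[x] 'C_G[y] by apply/comm_group_setP; rewrite defG groupP.
by rewrite -comC defG => ->.
Qed.

Lemma class_mul_small (gT : finGroupType) (G : {group gT}) x y :
    x \in G -> y \in G -> coprime #|x ^: G| #|y ^: G| ->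
    (#|(x * y)%g ^: G| <= #|x ^: G|)%N ->
  (#|<<[set (y ^ g * y^-1)%g | g in G]>>| %| #|x ^: G|)%N.
Proof.
move=> Gx Gy co_xy le_xy_x; set M := <<_>>; set S := x ^: G.
(* Each [S :* (y ^ g)] lies in the class of [x * y] and is at least as large, so all of them
   coincide and [S] is stable under right multiplication by [y ^ g * y^-1]. *)
have S_y g : g \in G -> S :* (y ^ g) = (x * y) ^: G.
  move=> Gg; apply/eqP; rewrite eqEcard card_rcoset le_xy_x andbT.
  apply/subsetP=> _ /rcosetP[_ /imsetP[h Gh ->] ->].
  exact: class_mul_coprime.
pose T := [set m | S :* m == S].
have gT_T: group_set T.
  apply/group_setP; split=> [|m n]; first by rewrite inE rcoset1.
  by rewrite !inE => /eqP Sm /eqP Sn; rewrite rcosetM Sm Sn.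
have sMT: M \subset group gT_T.
  rewrite gen_subG; apply/subsetP=> _ /imsetP[g Gg ->]; rewrite inE.
  by rewrite rcosetM (S_y g Gg) -(S_y 1 (group1 G)) conjg1 rcosetK.
have actsM: [acts M, on S | 'R].
  apply/subsetP=> m Mm; have := subsetP sMT m Mm; rewrite !inE => /eqP Sm.
  by apply/subsetP=> z Sz; rewrite inE /= -Sm mem_rcoset mulgK.
rewrite -[#|S|](acts_sum_card_orbit actsM); apply: dvdn_sum => _ /imsetP[z Sz ->].
by rewrite orbitR card_lcoset.
Qed.

(** The group generated by the [y ^ g * y^-1] has q-power order but lies in ['O_{t, p}(G)], whose
    order involves only [t] and [p]. If [q] differed from [p], it would be trivial and [y]
    central. *)
Lemma class_mul_small_prime (gT : finGroupType) (p q t : nat) (G : {group gT}) x y :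
    prime p -> prime q -> prime t -> q != t -> x \in G -> y \in G -> p.-elt y ->
    q.-nat #|x ^: G| -> t.-nat #|y ^: G| -> #|y ^: G| != 1%N ->
    (#|(x * y)%g ^: G| <= #|x ^: G|)%N ->
  q = p.
Proof.
move=> pr_p pr_q pr_t neq_qt Gx Gy p_y q_x t_y nt_y le_xy_x.
have co_xy: coprime #|x ^: G| #|y ^: G|.
  apply: pnat_coprime q_x _; apply: sub_in_pnat t_y => r _.
  by rewrite !inE => /eqP->; rewrite eq_sym.
apply/eqP; apply: contraR nt_y => neq_qp.
have := class_mul_small Gx Gy co_xy le_xy_x.
set M := <<_>> => M_dvd.
have Oy := prime_power_class_pseries2 pr_p pr_t Gy p_y t_y.
have sMO: M \subset 'O_{t, p}(G).
  rewrite gen_subG; apply/subsetP=> _ /imsetP[g Gg ->].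
  rewrite groupM ?groupV // memJ_norm //.
  by rewrite (subsetP (normal_norm (pseries_normal _ G))).
have q_M: q.-nat #|M| := pnat_dvd M_dvd q_x.
have q'O: q^'.-nat #|'O_{t, p}(G)|.
  have sOO: 'O_t(G) \subset 'O_{t, p}(G).
    by have := pseries_sub_catl [:: t : nat_pred] [:: p : nat_pred] G; rewrite pseries1.
  rewrite -(Lagrange sOO) pnatM; apply/andP; split.
    by apply: pi_pnat (pcore_pgroup t G) _; rewrite !inE eq_sym.
  rewrite -card_quotient; last by rewrite (subset_trans (pseries_sub _ _)) ?gFnorm.
  rewrite quotient_pseries2.
  by apply: pi_pnat (pcore_pgroup p _) _; rewrite !inE eq_sym.
have M1: M = 1.
  apply/eqP; rewrite trivg_card1; apply/eqP.
  exact: pnat_1 q_M (pnat_dvd (cardSg sMO) q'O).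
have -> : y ^: G = [set y]; last by rewrite cards1.
apply/eqP; rewrite eqEsubset sub1set class_refl andbT.
apply/subsetP=> _ /imsetP[g Gg ->]; rewrite inE eq_mulgV1 -in_set1.
by move/trivgP: M1 => /subsetP; apply; apply: mem_gen; apply/imsetP; exists g.
Qed.

Lemma class_mulC (gT : finGroupType) (G : {group gT}) x y :
  x \in G -> (x * y) ^: G = (y * x) ^: G.
Proof.
move=> Gx; have -> : y * x = (x * y) ^ x by rewrite conjgE mulgA mulKg.
by apply/esym/class_eqP; rewrite memJ_class.
Qed.

(** The class size of [x * y] divides the product of the other two and is a power of [s], which
    differs from [q] or from [t]; so it divides one factor, and [class_mul_small_prime] applies. *)
Lemma class_mul_types (gT : finGroupType) (p q t s : nat) (G : {group gT}) x y :
    prime p -> prime q -> prime t -> prime s -> q != t -> x \in G -> y \in G ->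
    p.-elt x -> p.-elt y ->
    q.-nat #|x ^: G| -> t.-nat #|y ^: G| -> s.-nat #|(x * y) ^: G| ->
    #|x ^: G| != 1%N -> #|y ^: G| != 1%N ->
  q = p /\ q.-nat #|(x * y) ^: G| \/ t = p /\ t.-nat #|(x * y) ^: G|.
Proof.
move=> pr_p pr_q pr_t pr_s neq_qt Gx Gy p_x p_y q_x t_y s_xy nt_x nt_y.
have co_xy: coprime #|x ^: G| #|y ^: G|.
  apply: pnat_coprime q_x _; apply: sub_in_pnat t_y => r _.
  by rewrite !inE => /eqP->; rewrite eq_sym.
have co_s u n : s != u -> u.-nat n -> coprime #|(x * y) ^: G| n.
  move=> neq_su u_n; apply: pnat_coprime s_xy _; apply: sub_in_pnat u_n => r _.
  by rewrite !inE => /eqP->; rewrite eq_sym.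
have dvd_xy := card_class_mul_dvd Gx Gy co_xy.
have cl_gt0 z : (0 < #|z ^: G|)%N by rewrite -index_cent1.
have [eq_st | neq_st] := eqVneq s t.
  have neq_sq: s != q by rewrite eq_st eq_sym.
  have dvd_y: (#|(x * y)%g ^: G| %| #|y ^: G|)%N.
    by rewrite -(Gauss_dvdr _ (co_s _ _ neq_sq q_x)).
  right; split; last exact: pnat_dvd dvd_y t_y.
  apply: (class_mul_small_prime pr_p pr_t pr_q _ Gy Gx p_x t_y q_x nt_x).
    by rewrite eq_sym.
  by rewrite -class_mulC // dvdn_leq.
have dvd_x: (#|(x * y)%g ^: G| %| #|x ^: G|)%N.
  by rewrite -(Gauss_dvdl _ (co_s _ _ neq_st t_y)).
left; split; last exact: pnat_dvd dvd_x q_x.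
apply: (class_mul_small_prime pr_p pr_q pr_t neq_qt Gx Gy p_y q_x t_y nt_y).
exact: dvdn_leq.
Qed.

(** * Sylow subgroups inside centralisers *)

Lemma p'_class_Sylow_cent1 (gT : finGroupType) (t : nat) (G : {group gT}) x :
    x \in G -> t^'.-nat #|x ^: G| ->
  exists2 V : {group gT}, t.-Sylow(G) V & V \subset 'C[x].
Proof.
move=> Gx t'x; have [V sylV] := Sylow_exists t 'C_G[x].
have sVC := pHall_sub sylV; have sCG: 'C_G[x] \subset G := subsetIl _ _.
exists V; last by rewrite (subset_trans sVC) ?subsetIr.
rewrite /pHall (subset_trans sVC) // (pHall_pgroup sylV).
rewrite -(Lagrange_index sCG sVC) pnatM index_cent1 t'x.
by case/and3P: sylV.
Qed.

Lemma pcore_sub_cent1 (gT : finGroupType) (t : nat) (G : {group gT}) x :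
  x \in G -> t^'.-nat #|x ^: G| -> 'O_t(G) \subset 'C[x].
Proof.
move=> Gx /(p'_class_Sylow_cent1 Gx)[V sylV]; apply: subset_trans.
exact: pcore_sub_Hall sylV.
Qed.

(** Some Sylow t-subgroup centralises [z]; the element taking it to [U] is a product of an element
    of ['C_G[z]] and some [u] in [P], and only [u] moves [z]. *)
Lemma Sylow_sub_cent1J (gT : finGroupType) (p t : nat) (G P U : {group gT}) z :
    z \in G -> p.-Sylow(G) P -> p.-nat #|z ^: G| -> t.-Sylow(G) U -> t != p ->
  exists2 u, u \in P & U \subset 'C[z ^ u].
Proof.
move=> Gz sylP p_z sylU neq_tp.
have defG := cent_coprime_class_mulG Gz sylP p_z.
have [|V sylV sVC] := @p'_class_Sylow_cent1 _ t G z Gz.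
  by apply: pi_pnat p_z _; rewrite !inE eq_sym.
have [g Gg DU] := Sylow_trans sylV sylU.
move: Gg; rewrite -defG => /mulsgP[c u /setIP[_ Cc] Pu Dg].
exists u => //; rewrite DU Dg conjsgM cent1J conjSg -(conjGid Cc).
by rewrite conjSg.
Qed.

(* Modulo the Frattini subgroup, ['O_p(G)] is generated by central elements and by
   elements centralised by [U], whence ['O_p(G) = 'C_('O_p(G))(U) * 'Z('O_p(G))]. *)
Lemma pcore_factor_cent (gT : finGroupType) (p t : nat) (G PA PB P U : {group gT}) :
    PA * PB = P -> p.-Sylow(G) P -> PA \subset 'O_p(G) ->
    {in PB, forall b, b \in 'O_p(G) \/ b \in 'C('O_p(G))} ->
    {in PA :|: PB, forall z, z \in 'O_p(G) ->
       p.-nat #|z ^: G| \/ z \in 'C('O_p(G))} ->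
    t.-Sylow(G) U -> t != p ->
  {in 'O_p(G), forall z, p.-nat #|z ^: G| -> U \subset 'C[z]}.
Proof.
set O := 'O_p(G) => defP sylP sAO hB hz sylU neq_tp.
have pO: p.-group O := pcore_pgroup p G.
have sOG: O \subset G := pcore_sub p G.
have sOP: O \subset PA * PB by rewrite defP pcore_sub_Hall.
have conjO z : z \in O -> p.-nat #|z ^: G| -> exists2 o, o \in O & U \subset 'C[z ^ o].
  move=> Oz p_z.
  have [u] := Sylow_sub_cent1J (subsetP sOG z Oz) sylP p_z sylU neq_tp.
  rewrite -defP => /mulsgP[a b Aa Bb ->] sU.
  have Oa := subsetP sAO a Aa.
  (* A factor [b] centralising [O] fixes [z ^ a], so the conjugator can be chosen in [O]. *)
  have [Ob | Cb] := hB b Bb; first by exists (a * b) => //; rewrite groupM.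
  exists a => //; rewrite conjgM in sU.
  have : (z ^ a) ^ b = z ^ a; last by move <-.
  by apply/conjg_fixP/commgP/esym/(centP Cb); rewrite groupJ.
pose W := ('C_O(U) <*> 'Z(O))%G.
have sWO: W \subset O by rewrite join_subG !subsetIl.
have gen_z z : z \in PA :|: PB -> z \in O -> z \in 'Phi(O) <*> W.
  move=> ABz Oz; have [p_z | Cz] := hz z ABz Oz; last first.
    apply: (subsetP (joing_subr _ _)); apply: (subsetP (joing_subr _ _)).
    by rewrite inE Oz.
  have [o Oo sU] := conjO z Oz p_z.
  have -> : z = z ^ o * [~ z, o]^-1.
    by rewrite commgEl invMg invgK mulKVg.
  rewrite groupM ?groupV //.
    apply: (subsetP (joing_subr _ _)); apply: (subsetP (joing_subl _ _)).
    rewrite inE groupJ //=; apply/centP=> u Uu.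
    by apply/esym/cent1P/(subsetP sU).
  apply: (subsetP (joing_subl _ _)); rewrite (Phi_joing pO).
  by apply: (subsetP (joing_subl _ _)); rewrite mem_commg.
have defW : W :=: O.
  rewrite -[LHS]genGid; apply: Phi_nongen.
  apply/eqP; rewrite eqEsubset join_subG Phi_sub sWO /=.
  apply/subsetP=> o Oo; have /mulsgP[a b Aa Bb Do] := subsetP sOP o Oo.
  have Oa := subsetP sAO a Aa.
  have Ob: b \in O by rewrite -(groupMl _ Oa) -Do.
  by rewrite Do groupM //; apply: gen_z => //; rewrite inE ?Aa ?Bb ?orbT.
move=> z Oz p_z; have [o Oo sU] := conjO z Oz p_z.
have nZ: 'C_O(U) \subset 'N('Z(O)).
  by rewrite (subset_trans (subsetIl _ _)) ?gFnorm.
(* The central factor of [o] fixes [z] and the other one normalises [U], so [o] can be removed from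
   [z ^ o]. *)
have: o \in 'Z(O) * 'C_O(U) by rewrite -normC // -norm_joinEl // -/(gval W) defW.
case/mulsgP=> y c /setIP[Oy Cy] /setIP[Oc Cc] Do.
move: sU; rewrite Do conjgM (_ : z ^ y = z); last first.
  by apply/conjg_fixP/commgP/esym/(centP Cy).
rewrite cent1J -sub_conjgV.
have nUc: c^-1 \in 'N(U) by rewrite groupV (subsetP (cent_sub U)).
by rewrite (normP nUc).
Qed.

(** * The primes attached to the two factors *)

Lemma cl_indexE (gT : finGroupType) (G : {group gT}) x : cl_index G x = #|x ^: G|.
Proof. exact: index_cent1. Qed.

Lemma Baer_factorisationC (gT : finGroupType) (p : nat) (G A B : {group gT}) :
  Baer_factorisation p G A B -> Baer_factorisation p G B A.
Proof.
case=> defG Bpp; split=> [|x]; last by rewrite setUC; apply: Bpp.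
by rewrite -defG; apply/esym/comm_group_setP; rewrite defG groupP.
Qed.

(** Multiplication by [x] turns elements of [PA] with non-trivial classes for other primes into
    elements with p-power classes, so [PA] lies in ['O_p(G)]. Then a Sylow t-subgroup centralises
    [x] and [x * y], hence [y], whose class size is thus prime to [t]. *)
Lemma mixed_class_primes_trivial (gT : finGroupType) (p t : nat) (G PA PB P : {group gT}) x y :
    prime p -> prime t -> t != p -> p.-Sylow(G) P -> PA * PB = P ->
    {in PA :|: PB, forall z, prime_power #|z ^: G|} ->
    x \in PA -> y \in PA -> p.-nat #|x ^: G| -> t.-nat #|y ^: G| ->
    #|x ^: G| != 1%N -> #|y ^: G| = 1%N.
Proof.
move=> pr_p pr_t neq_tp sylP defP pp PAx PAy p_x t_y nt_x.
apply/eqP/contraT=> nt_y.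
have sPAP: PA \subset P by rewrite -defP mulG_subl.
have sPBP: PB \subset P by rewrite -defP mulG_subr.
have sPG := pHall_sub sylP; have pP := pHall_pgroup sylP.
have elt z : z \in PA :|: PB -> z \in G /\ p.-elt z.
  move=> ABz; have Pz: z \in P.
    by case/setUP: ABz; [apply: (subsetP sPAP) | apply: (subsetP sPBP)].
  by split; [apply: (subsetP sPG) | apply: mem_p_elt Pz].
have PAE z : z \in PA -> z \in PA :|: PB by move=> PAz; rewrite inE PAz.
have cent z u : u != p -> z \in G -> u.-nat #|z ^: G| -> z \in 'C('O_p(G)).
  move=> neq_up Gz u_z; rewrite -sub_cent1; apply: pcore_sub_cent1 => //.
  by apply: pi_pnat u_z _; rewrite !inE.
have mixed z u : prime u -> u != p -> z \in PA -> u.-nat #|z ^: G| ->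
    #|z ^: G| != 1%N -> p.-nat #|(x * z) ^: G|.
  move=> pr_u neq_up PAz u_z nt_z.
  have [Gx p_eltx] := elt x (PAE x PAx); have [Gz p_eltz] := elt z (PAE z PAz).
  have [s pr_s s_xz] := pp _ (PAE _ (groupM PAx PAz)).
  have [|[_ //]|[eq_up]] :=
      class_mul_types pr_p pr_p pr_u pr_s _ Gx Gz p_eltx p_eltz p_x u_z s_xz nt_x nt_z.
    by rewrite eq_sym.
  by rewrite eq_up eqxx in neq_up.
have Op z : z \in PA :|: PB -> p.-nat #|z ^: G| -> z \in 'O_p(G).
  by move=> /elt[Gz p_z]; apply: class_pnat_pcore.
have sPAO: PA \subset 'O_p(G).
  apply/subsetP=> z PAz; have [u pr_u u_z] := pp z (PAE z PAz).
  have [z1 | nt_z] := eqVneq #|z ^: G| 1%N; first by rewrite Op ?PAE ?z1.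
  have [eq_up | neq_up] := eqVneq u p; first by rewrite Op ?PAE -?eq_up.
  have p_xz := mixed z u pr_u neq_up PAz u_z nt_z.
  have Ox: x \in 'O_p(G) by rewrite Op ?PAE.
  by rewrite -(groupMl _ Ox) Op // PAE ?groupM.
have dich z : z \in PA :|: PB -> p.-nat #|z ^: G| \/ z \in 'C('O_p(G)).
  move=> ABz; have [u pr_u u_z] := pp z ABz.
  have [eq_up | neq_up] := eqVneq u p; first by left; rewrite -eq_up.
  by right; apply: cent u_z => //; case: (elt z ABz).
have [U sylU] := Sylow_exists t G.
have centU := pcore_factor_cent defP sylP sPAO _ _ sylU neq_tp.
have{centU} centU: {in 'O_p(G), forall z, p.-nat #|z ^: G| -> U \subset 'C[z]}.
  apply: centU => z; last by move=> ABz _; apply: dich.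
  move=> PBz; have ABz: z \in PA :|: PB by rewrite inE PBz orbT.
  by case: (dich z ABz) => [p_z|]; [left; apply: Op | right].
have p_xy := mixed y t pr_t neq_tp PAy t_y nt_y.
have Ux: U \subset 'C[x] by rewrite centU // (subsetP sPAO).
have Uxy: U \subset 'C[x * y] by rewrite centU // (subsetP sPAO) ?groupM.
have Uy: U \subset 'C[y].
  rewrite sub_cent1 -(groupMl y (_ : x \in 'C(U))) -sub_cent1 //.
have [Gy _] := elt y (PAE y PAy).
have t'y: t^'.-nat #|y ^: G|.
  have sUC: U \subset 'C_G[y] by rewrite subsetI (pHall_sub sylU).
  rewrite -index_cent1; apply: pnat_dvd (indexgS G sUC) _.
  by case/and3P: sylU.
by rewrite (pnat_1 t_y t'y) in nt_y.
Qed.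

Lemma index_prime_Sylow (gT : finGroupType) (p q : nat) (G A PA : {group gT}) :
    prime q -> A \subset G -> p.-Sylow(A) PA ->
    {in PA, forall z, q.-nat #|z ^: G|} ->
  index_prime p G A q.
Proof.
move=> pr_q sAG sylPA q_PA; split=> // z Az p_z; rewrite cl_indexE.
have sz: <[z]> \subset A by rewrite cycle_subG.
have [a Aa] := Sylow_Jsub sylPA sz p_z.
rewrite -cycleJ cycle_subG => /q_PA.
by rewrite classGidl // (subsetP sAG).
Qed.

(** If two elements of [PA] had non-trivial classes for distinct primes, one of these would be [p]
    by [class_mul_types], which [mixed_class_primes_trivial] excludes. *)
Lemma index_prime_exists (gT : finGroupType) (p : nat) (G A B : {group gT}) :
  prime p -> Baer_factorisation p G A B -> exists q, index_prime p G A q.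
Proof.
move=> pr_p [defG Bpp].
have [PA [PB [P [sylPA sylPB sylP defP]]]] := factorised_Sylow_exists p defG.
have sAG: A \subset G by rewrite -defG mulG_subl.
have sBG: B \subset G by rewrite -defG mulG_subr.
have pp: {in PA :|: PB, forall z, prime_power #|z ^: G|}.
  move=> z /setUP ABz; rewrite -cl_indexE; apply: Bpp; last first.
    by case: ABz; apply: mem_p_elt; apply: pHall_pgroup; [apply: sylPA | apply: sylPB].
  rewrite inE; case: ABz => [/(subsetP (pHall_sub sylPA))-> //|].
  by move/(subsetP (pHall_sub sylPB))->; rewrite orbT.
have PAE z : z \in PA -> z \in PA :|: PB by move=> PAz; rewrite inE PAz.
have [/existsP[x /andP[PAx nt_x]] | /existsPn triv] :=
    boolP [exists x, (x \in PA) && (#|x ^: G| != 1%N)]; last first.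
  exists p; apply: (index_prime_Sylow pr_p sAG sylPA) => z PAz.
  by have:= triv z; rewrite PAz negbK => /eqP->.
have [q pr_q q_x] := pp x (PAE x PAx).
exists q; apply: (index_prime_Sylow pr_q sAG sylPA) => y PAy.
apply: contraT => q'y; have [t pr_t t_y] := pp y (PAE y PAy).
have nt_y: #|y ^: G| != 1%N by apply: contraNneq q'y => ->.
have neq_qt: q != t by apply: contraNneq q'y => ->.
have [s pr_s s_xy] := pp _ (PAE _ (groupM PAx PAy)).
have elt z : z \in PA -> z \in G /\ p.-elt z.
  move=> PAz; split; first by rewrite (subsetP sAG) // (subsetP (pHall_sub sylPA)).
  exact: mem_p_elt (pHall_pgroup sylPA) PAz.
have [[Gx px] [Gy py]] := (elt x PAx, elt y PAy).
have [[eq_qp _]|[eq_tp _]] :=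
    class_mul_types pr_p pr_q pr_t pr_s neq_qt Gx Gy px py q_x t_y s_xy nt_x nt_y.
  rewrite eq_qp in q_x neq_qt; rewrite eq_sym in neq_qt.
  by rewrite (mixed_class_primes_trivial pr_p pr_t neq_qt sylP defP pp PAx PAy) ?eqxx in nt_y.
rewrite eq_tp in t_y neq_qt.
by rewrite (mixed_class_primes_trivial pr_p pr_q neq_qt sylP defP pp PAy PAx) ?eqxx in nt_x.
Qed.

Lemma index_prime_unique (gT : finGroupType) (p : nat) (G A B : {group gT}) :
  prime p -> Baer_factorisation p G A B -> exists_unique_index_prime p G A.
Proof.
move=> pr_p BF; have exq := index_prime_exists pr_p BF; split=> // -[x [Ax p_x nt_x]].
have [q iq] := exq; exists q; split=> // q' [pr_q' iq'].
have [pr_q iq1] := iq; apply/eqP; apply: contraT => neq_qq'; case: nt_x.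
apply: pnat_1 (iq1 x Ax p_x) _.
by apply: pi_pnat (iq' x Ax p_x) _; rewrite !inE eq_sym.
Qed.

(** * Consequences for the structure of [G] *)

(** For each prime [t] other than [q], [x] centralises ['O_t(G)] and with it the Sylow t-subgroup of
    [K]; so no prime divides the index of ['C_K[x]] in [K]. *)
Lemma nilpotent_sub_cent1 (gT : finGroupType) (q : nat) (G K : {group gT}) x :
    x \in G -> nilpotent K -> K <| G -> q.-nat #|x ^: G| -> q^'.-group K ->
  K \subset 'C[x].
Proof.
move=> Gx nilK nsKG q_x q'K.
have sCK: 'C_K[x] \subset K := subsetIl _ _.
have : #|K : 'C_K[x]| = 1%N.
  apply: (@pnat_1 pred0); last by apply/pnatP => // r _ _; rewrite !inE.
  apply/pnatP => // t pr_t t_dvd.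
  have tK: t \in \pi(K).
    by rewrite mem_primes pr_t cardG_gt0 (dvdn_trans t_dvd) ?dvdn_indexg.
  have t'x: t^'.-nat #|x ^: G|.
    apply: pi_pnat q_x _; rewrite !inE; apply: contraTneq q'K => eq_qt.
    apply/negP=> q'K; have := pnatPpi q'K tK.
    by rewrite !inE eq_qt eqxx.
  have sO: 'O_t(K) \subset 'C_K[x].
    rewrite subsetI pcore_sub (subset_trans _ (pcore_sub_cent1 Gx t'x)) //.
    by rewrite pcore_max ?pcore_pgroup ?gFnormal_trans.
  have t'i: t^'.-nat #|K : 'C_K[x]|.
    apply: pnat_dvd (indexgS K sO) _.
    by case/and3P: (nilpotent_pcore_Hall t nilK).
  by move: t'i; rewrite p'natE // t_dvd.
by move/eqP; rewrite indexg_eq1 subsetI => /andP[].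
Qed.

(** ['C_G(P)] contains a Sylow t-subgroup for each prime [t] other than [p], so modulo it [G] is a
    p-group, in which a Schur-Zassenhaus complement of [P] has trivial image. *)
Lemma Sylow_decomposable (gT : finGroupType) (p : nat) (G P : {group gT}) :
    p.-Sylow(G) P -> P <| G ->
    (forall t (U : {group gT}), t != p -> t.-Sylow(G) U -> U \subset 'C(P)) ->
  p_decomposable p G.
Proof.
move=> sylP nsPG centU; have hallP := pHall_Hall sylP.
have [W /complP[tiPW defG]] := splitsP (SchurZassenhaus_split hallP nsPG).
have sWG: W \subset G by rewrite -defG mulG_subr.
have nsCG: 'C_G(P) <| G.
  by rewrite -[X in 'C_G(X)]/(gval P); apply: norm_normalI; rewrite norms_cent ?normal_norm.
have p_GC: p.-group (G / 'C_G(P)).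
  rewrite /pgroup card_quotient ?normal_norm //; apply/pnatP => // t pr_t t_dvd.
  rewrite inE /=; apply: contraLR t_dvd => neq_tp.
  have [U sylU] := Sylow_exists t G.
  have sUC: U \subset 'C_G(P) by rewrite subsetI (pHall_sub sylU) (centU t).
  have: t^'.-nat #|G : 'C_G(P)|.
    by apply: pnat_dvd (indexgS G sUC) _; case/and3P: sylU.
  by rewrite p'natE.
have oG: #|G| = (#|P| * #|W|)%N by rewrite -defG TI_cardMg.
have p'W: p^'.-group W.
  have /and3P[_ _] := sylP.
  by rewrite -divgS ?(pHall_sub sylP) // oG mulKn.
have cPW: W \subset 'C(P).
  have nCW: W \subset 'N('C_G(P)) := subset_trans sWG (normal_norm nsCG).
  apply: subset_trans (subsetIr G 'C(P)); rewrite -quotient_sub1 //.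
  apply/trivgP/eqP; rewrite trivg_card1; apply/eqP.
  apply: (@pnat_1 p); first exact: pgroupS (quotientS _ sWG) p_GC.
  exact: quotient_pgroup.
have nsWG: W <| G.
  by rewrite /normal sWG -defG mul_subG ?normG // (subset_trans _ (cent_sub W)) // centsC.
have hallW: p^'.-Hall(G) W.
  rewrite /pHall sWG p'W -divgS // oG mulnK // pnatNK.
  exact: pHall_pgroup sylP.
rewrite /p_decomposable (normal_Hall_pcore sylP nsPG) (normal_Hall_pcore hallW nsWG).
by rewrite dprodE.
Qed.

Theorem theorem2 (gT : finGroupType) (p : nat) (G A B P : {group gT})
    (hp : p \in \pi(G))
    (hBaer : Baer_factorisation p G A B)
    (hP : p.-Sylow(G) P) :
  [/\ exists_unique_index_prime p G A,
      exists_unique_index_prime p G B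
    & forall q r : nat, index_prime p G A q -> index_prime p G B r ->
      [/\ P \subset 'C_G('O_(pred2 q r)^'('F(G))),
          P * 'O_q(G) * 'O_r(G) <| G,
          q = p /\ r = p -> p_decomposable p G
        & p <> q /\ p <> r -> abelian P]].
Proof.
have pr_p: prime p by move: hp; rewrite mem_primes => /andP[].
split; [exact: index_prime_unique hBaer | |].
  exact: index_prime_unique (Baer_factorisationC hBaer).
move=> q r [pr_q q_A] [pr_r r_B]; have [defG _] := hBaer; have sylP := hP.
have [PA [PB [P0 [sylPA sylPB sylP0 defP0]]]] := factorised_Sylow_exists p defG.
have sAG: A \subset G by rewrite -defG mulG_subl.
have sBG: B \subset G by rewrite -defG mulG_subr.
have [g Gg DP] := Sylow_trans sylP0 sylP.
have qA z : z \in PA -> [/\ z \in G, p.-elt z & q.-nat #|z ^: G|].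
  move=> PAz; have Az := subsetP (pHall_sub sylPA) z PAz.
  have p_z := mem_p_elt (pHall_pgroup sylPA) PAz.
  by split=> //; [apply: (subsetP sAG) | rewrite -cl_indexE q_A].
have rB z : z \in PB -> [/\ z \in G, p.-elt z & r.-nat #|z ^: G|].
  move=> PBz; have Bz := subsetP (pHall_sub sylPB) z PBz.
  have p_z := mem_p_elt (pHall_pgroup sylPB) PBz.
  by split=> //; [apply: (subsetP sBG) | rewrite -cl_indexE r_B].
(* [P] is conjugate to [PA * PB], so a normal subgroup containing both factors contains [P]. *)
have P0_sub (H : {group gT}) : H <| G ->
    {in PA, forall z, z \in H} -> {in PB, forall z, z \in H} -> P \subset H.
  move=> /andP[_ nHG] HA HB; rewrite DP /= -(normsP nHG g Gg) conjSg -defP0.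
  by rewrite mul_subG //; apply/subsetP.
have sPG := pHall_sub sylP; have pP := pHall_pgroup sylP.
have [R nsRG defR]: exists2 R : {group gT}, R <| G & 'O_q(G) * 'O_r(G) = R.
  exists ('O_q(G) <*> 'O_r(G))%G; first by rewrite normalY ?pcore_normal.
  by rewrite -norm_joinEr // (subset_trans (pcore_sub _ _)) ?gFnorm.
have sqR: 'O_q(G) \subset R by rewrite -defR mulG_subl.
have srR: 'O_r(G) \subset R by rewrite -defR mulG_subr.
set Y := ('O_{q, p}(G) <*> 'O_{r, p}(G))%G.
have nsYG: Y <| G by rewrite normalY ?pseries_normal.
have sYA z : z \in PA -> z \in Y.
  move=> /qA[Gz p_z q_z]; apply: (subsetP (joing_subl _ _)).
  exact: prime_power_class_pseries2.
have sYB z : z \in PB -> z \in Y.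
  move=> /rB[Gz p_z r_z]; apply: (subsetP (joing_subr _ _)).
  exact: prime_power_class_pseries2.
have sPY: P \subset Y := P0_sub Y nsYG sYA sYB.
have nRG := normal_norm nsRG; have sYG := normal_sub nsYG.
have nRY: Y \subset 'N(R) := subset_trans sYG nRG.
have p_YR: p.-group (Y / R).
  have nR1 u : 'O_{u, p}(G) \subset 'N(R) by rewrite (subset_trans (pseries_sub _ _)).
  have nOO: 'O_{q, p}(G) / R \subset 'N('O_{r, p}(G) / R).
    by apply: quotient_norms; rewrite (subset_trans (pseries_sub _ _)) ?gFnorm.
  rewrite /= quotientY // (norm_joinEl nOO) pgroupM.
  by apply/andP; split; apply: pseries2_pgroup_quotient.
(* Stated for all Sylow p-subgroups, because [centY] uses it for one that depends on [z]. *)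
have Sylow_R (V : {group gT}) : p.-Sylow(G) V -> V / R = Y / R.
  move=> sylV; have sVY: V \subset Y.
    have [h Gh ->] := Sylow_trans sylP sylV.
    by rewrite -(normsP (normal_norm nsYG) h Gh) conjSg.
  apply: (pHall_id _ p_YR); rewrite quotient_pHall ?(subset_trans sVY) //.
  exact: pHall_subl sVY sYG sylV.
have sRY: R \subset Y.
  have sO u : 'O_u(G) \subset 'O_{u, p}(G).
    by have := pseries_sub_catl [:: u : nat_pred] [:: p : nat_pred] G; rewrite pseries1.
  rewrite -defR; apply: mul_subG.
    exact: subset_trans (sO q) (joing_subl _ _).
  exact: subset_trans (sO r) (joing_subr _ _).
have defY: P * R = Y.
  have nRP : P \subset 'N(R) := subset_trans sPG nRG.
  by rewrite (normC nRP) -quotientK // (Sylow_R P sylP) quotientGK // (normalS sRY sYG).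
split.
- set K := 'O__('F(G)).
  have nsKG: K <| G by rewrite !gFnormal_trans.
  have nilK: nilpotent K := nilpotentS (pcore_sub _ _) (Fitting_nil G).
  have nsCG: 'C_G(K) <| G by rewrite norm_normalI ?norms_cent ?normal_norm.
  have u'K u : u \in pred2 q r -> u^'.-group K.
    move=> qr_u; apply: sub_pgroup (pcore_pgroup _ _) => v.
    by rewrite !inE; apply: contra => /eqP->.
  apply: (P0_sub ('C_G(K))%G nsCG) => z.
    move=> /qA[Gz _ q_z]; rewrite inE Gz -sub_cent1.
    by rewrite (nilpotent_sub_cent1 Gz nilK nsKG q_z) // u'K // !inE eqxx.
  move=> /rB[Gz _ r_z]; rewrite inE Gz -sub_cent1.
  by rewrite (nilpotent_sub_cent1 Gz nilK nsKG r_z) // u'K // !inE eqxx orbT.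
- by rewrite -mulgA defR defY.
- move=> [eq_qp eq_rp]; rewrite {}eq_qp {}eq_rp in qA rB.
  have OA z : z \in PA -> z \in 'O_p(G) by move=> /qA[]; apply: class_pnat_pcore.
  have OB z : z \in PB -> z \in 'O_p(G) by move=> /rB[]; apply: class_pnat_pcore.
  have defP: P :=: 'O_p(G).
    apply/eqP; rewrite eqEsubset (pcore_sub_Hall sylP) andbT.
    exact: (P0_sub _ (pcore_normal p G) OA OB).
  have defP00: P0 :=: 'O_p(G).
    apply/eqP; rewrite eqEsubset (pcore_sub_Hall sylP0) andbT -defP0.
    by rewrite mul_subG //; apply/subsetP.
  apply: (Sylow_decomposable sylP); first by rewrite defP pcore_normal.
  move=> t U neq_tp sylU; rewrite centsC defP -defP00 -defP0.
  have centU: {in 'O_p(G), forall z, p.-nat #|z ^: G| -> U \subset 'C[z]}.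
    apply: (pcore_factor_cent defP0 sylP0 _ _ _ sylU neq_tp).
    - exact/subsetP.
    - by move=> z /OB; left.
    by move=> z /setUP[/qA | /rB] [_ _ p_z]; left.
  apply: mul_subG; apply/subsetP=> z; rewrite -sub_cent1 => ABz.
    by apply: (centU z (OA z ABz)); case: (qA z ABz).
  by apply: (centU z (OB z ABz)); case: (rB z ABz).
move=> [/eqP neq_pq /eqP neq_pr].
have p'R: p^'.-group R.
  rewrite -defR pgroupM; apply/andP; split.
    by apply: pi_pnat (pcore_pgroup q G) _; rewrite !inE eq_sym.
  by apply: pi_pnat (pcore_pgroup r G) _; rewrite !inE eq_sym.
(* [z] centralises some Sylow p-subgroup [V], whose image modulo [R] is all of [Y / R]. *)
have centY z : z \in G -> p^'.-nat #|z ^: G| -> coset R z \in 'C(Y / R).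
  move=> Gz /(p'_class_Sylow_cent1 Gz)[V sylV sVC].
  rewrite -(Sylow_R V sylV).
  have czV: <[z]> \subset 'C(V) by rewrite cycle_subG -sub_cent1.
  apply: (subsetP (quotient_cents R czV)).
  by rewrite mem_quotient ?cycle_id.
have cA: PA / R \subset 'C(Y / R).
  apply/subsetP=> _ /morphimP[z _ /qA[Gz _ q_z] ->]; apply: centY => //.
  by apply: pi_pnat q_z _; rewrite !inE eq_sym.
have cB: PB / R \subset 'C(Y / R).
  apply/subsetP=> _ /morphimP[z _ /rB[Gz _ r_z] ->]; apply: centY => //.
  by apply: pi_pnat r_z _; rewrite !inE eq_sym.
have cYY: abelian (P / R).
  rewrite (Sylow_R P sylP) /abelian -{1}(Sylow_R P0 sylP0) -defP0.
  rewrite quotientMl ?mul_subG //.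
  by rewrite (subset_trans (pHall_sub sylPA)) ?(subset_trans sAG).
(* The derived subgroup of [P] lies in the p'-group [R], hence is trivial. *)
apply/derG1P/trivgP; have <- : R :&: P = 1.
  by apply: coprime_TIg; rewrite coprime_sym (pnat_coprime pP).
by rewrite subsetI der_sub der1_min // (subset_trans sPG).
Qed.
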